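(* Let $n\ge2$. In $\mathbb{R}^3$, there are only three types of $(n+1)$-body central configurations all of whose $n$-body subsets form a central configuration, namely: the three-body Eulerian collinear central configurations (collinear central configurations of three bodies), the Lagrangian equilateral triangle central configurations (three arbitrary masses at the vertices of an equilateral triangle), and the regular tetrahedron central configurations (four arbitrary masses at the vertices of a regular tetrahedron).
   Context: All masses are positive, and the bodies of a configuration occupy pairwise distinct positions in $\mathbb{R}^3$. For bodies with masses $m_1,\dots,m_k$ at $\mathbf{q}_1,\dots,\mathbf{q}_k$ ($k\ge2$) put $m=\sum_i m_i$, $c=\frac1m\sum_i m_i\mathbf{q}_i$, $U=\sum_{i<j}\frac{m_im_j}{|\mathbf{q}_i-\mathbf{q}_j|}$, $I=\sum_i m_i|\mathbf{q}_i-c|^2$. The configuration is central if $\nabla U+\frac{\lambda}{2}\nabla I=0$ with $\lambda=U/I$, i.e. $\sum_{j\ne i} m_im_j\frac{\mathbf{q}_j-\mathbf{q}_i}{|\mathbf{q}_j-\mathbf{q}_i|^3}=-\lambda m_i(\mathbf{q}_i-c)$ for all $i$. An $n$-body subset of an $(n+1)$-body configuration is obtained by removing one body, the others keeping their masses and positions. *)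

(* Defs.v *)
From HB Require Import structures.
From mathcomp Require Import all_boot all_order all_algebra.
From mathcomp Require Import reals.

Set Implicit Arguments.
Unset Strict Implicit.
Unset Printing Implicit Defensive.

Import Order.TTheory GRing.Theory Num.Theory.
Local Open Scope ring_scope.

(* The Euclidean norm; the norm `|v| which MathComp-Analysis puts on row
   vectors is the sup norm. *)
Definition enorm (R : realType) (d : nat) (v : 'rV[R]_d) : R :=
  Num.sqrt (\sum_(l < d) v 0 l ^+ 2).

Section Configurations.
Variables (R : realType) (k : nat).
Variables (m : 'I_k -> R) (q : 'I_k -> 'rV[R]_3).

Definition total_mass : R := \sum_(i < k) m i.

Definition mass_center : 'rV[R]_3 :=
  total_mass^-1 *: \sum_(i < k) m i *: q i.

Definition potential : R :=
  \sum_(i < k) \sum_(j < k | (i < j)%N) m i * m j / enorm (q i - q j).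

Definition inertia : R :=
  \sum_(i < k) m i * enorm (q i - mass_center) ^+ 2.

(* The equation grad U + (lambda / 2) grad I = 0 with lambda = U / I, written
   out body by body: the i-th block of grad U is the left-hand side, and the
   i-th block of grad I is 2 m_i (q_i - c). *)
Definition central : Prop :=
  forall i : 'I_k,
    \sum_(j < k | j != i)
       (m i * m j / enorm (q j - q i) ^+ 3) *: (q j - q i)
    = - (potential / inertia * m i) *: (q i - mass_center).

Definition collinear : Prop :=
  exists (a u : 'rV[R]_3), u != 0 /\ forall i, exists t : R, q i = a + t *: u.

Definition equidistant : Prop :=
  exists2 s : R, 0 < s & forall i j, i != j -> enorm (q i - q j) = s.

Definition eulerian : Prop := [/\ k = 3, collinear & central].

(* In the next two types the masses are arbitrary, so nothing is asked of m;
   three (resp. four) points at equal positive mutual distances are exactly the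
   vertices of an equilateral triangle (resp. a regular tetrahedron). *)
Definition equilateral_triangle : Prop := k = 3 /\ equidistant.

Definition regular_tetrahedron : Prop := k = 4 /\ equidistant.

End Configurations.

(* Main.v *)
(* Subtract the equations of the subset without the body b from those of the
   whole configuration.  For every i <> b this leaves
     (r_ib^-3 + g) (q_i - q_b) = v
   with g and v independent of i.  If v <> 0 for some b, all the bodies lie on
   a line through q_b.  If v = 0 for every b, each body is equidistant from all
   the others, so there are at most four bodies.  On a line, take b to be an
   endpoint: the distances to b are positive roots of a cubic without linear
   term, which has at most two of them, so there are only three bodies. *)
Require Import Defs.
From mathcomp Require Import all_boot all_order all_algebra.
From mathcomp Require Import ring lra.
From mathcomp Require Import boolp reals.

Import Order.TTheory GRing.Theory Num.Theory.
Local Open Scope ring_scope.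

(** * The Euclidean norm and equidistant points *)

Lemma enorm_sqr (R : realType) (d : nat) (v : 'rV[R]_d) :
  enorm v ^+ 2 = \sum_(l < d) v 0 l ^+ 2.
Proof. by rewrite sqr_sqrtr ?sumr_ge0// => l _; rewrite sqr_ge0. Qed.

Lemma enorm0 (R : realType) (d : nat) : enorm (0 : 'rV[R]_d) = 0.
Proof.
by rewrite /enorm big1 ?sqrtr0// => l _; rewrite mxE expr0n.
Qed.

Lemma enormZ (R : realType) (d : nat) (t : R) (v : 'rV[R]_d) :
  enorm (t *: v) = `|t| * enorm v.
Proof.
rewrite /enorm -sqrtr_sqr -sqrtrM ?sqr_ge0// mulr_sumr.
by congr Num.sqrt; apply: eq_bigr => l _; rewrite mxE exprMn.
Qed.

Lemma enormB (R : realType) (d : nat) (u v : 'rV[R]_d) :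
  enorm (u - v) = enorm (v - u).
Proof. by rewrite -opprB -scaleN1r enormZ normrN1 mul1r. Qed.

Lemma enorm_gt0 (R : realType) (d : nat) (v : 'rV[R]_d) :
  (0 < enorm v) = (v != 0).
Proof.
have [->|v0] := eqVneq v 0; first by rewrite enorm0 ltxx.
rewrite sqrtr_gt0 lt_def sumr_ge0 ?andbT => [|l _]; last exact: sqr_ge0.
apply: contra v0; rewrite psumr_eq0 => [/allP h|l _]; last exact: sqr_ge0.
apply/eqP/rowP => l; rewrite mxE; apply/eqP.
by rewrite -sqrf_eq0; apply: (implyP (h l (mem_index_enum l))).
Qed.

Lemma enorm_subr_gt0 (R : realType) (k d : nat) (q : 'I_k -> 'rV[R]_d)
    (i j : 'I_k) : injective q -> i != j -> 0 < enorm (q i - q j).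
Proof. by move=> q_inj ij; rewrite enorm_gt0 subr_eq0 (inj_eq q_inj). Qed.

Lemma enorm_sqrB (R : realType) (d : nat) (u v : 'rV[R]_d) :
  enorm (u - v) ^+ 2
    = enorm u ^+ 2 + enorm v ^+ 2 - (\sum_(l < d) u 0 l * v 0 l) *+ 2.
Proof.
rewrite !enorm_sqr -sumrMnl -big_split -sumrB /=.
by apply: eq_bigr => l _; rewrite !mxE; ring.
Qed.

(** The vectors from the first point to the [k] others have Gram matrix [s ^+ 2 / 2] times (identity
    + all-ones), which is nonsingular, so they are linearly independent. *)
Lemma equidistant_card (R : realType) (k d : nat) (q : 'I_k.+1 -> 'rV[R]_d)
    (s : R) :
  0 < s -> (forall i j, i != j -> enorm (q i - q j) = s) -> (k <= d)%N.
Proof.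
move=> s_gt0 qs.
pose V : 'M[R]_(k, d) := \matrix_i (q (lift ord0 i) - q ord0).
have gram i j : (V *m V^T) i j *+ 2 = s ^+ 2 *+ (i == j).+1.
  have Vs a : enorm (q (lift ord0 a) - q ord0) = s by rewrite qs.
  have := enorm_sqrB _ _ (q (lift ord0 i) - q ord0) (q (lift ord0 j) - q ord0).
  rewrite !Vs mxE opprB addrA subrK.
  under [X in _ = _ - X *+ 2 -> _]eq_bigr => l _.
    rewrite (_ : _ * _ = V i l * V^T l j); last by rewrite !mxE.
    over.
  set x := \sum_l _.
  have [->|ij] := eqVneq i j; first by rewrite subrr enorm0 expr0n /=; lra.
  by rewrite qs ?(inj_eq lift_inj)//=; lra.
suff: row_free V by rewrite -row_leq_rank => /leq_trans; apply; exact: rank_leq_col.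
apply/inj_row_free => a aV.
pose A := \sum_i a 0 i.
(* Twice the [j]-th entry of [a *m V *m V^T = 0] is [s ^+ 2 * (A + a 0 j)]. Summing over [j] below
   gives [(k + 1) A = 0]. *)
have aE j : a 0 j = - A.
  have : \sum_i a 0 i * ((V *m V^T) i j *+ 2) = 0.
    transitivity (((a *m V) *m V^T) 0 j *+ 2).
      by rewrite -mulmxA mxE -sumrMnl; apply: eq_bigr => i _; rewrite mulrnAr.
    by rewrite aV mul0mx mxE mul0rn.
  under eq_bigr do rewrite gram mulrS mulrDr.
  rewrite big_split /= -mulr_suml -/A (bigD1 j)//= eqxx big1 ?addr0.
    rewrite -mulrDl => /eqP; rewrite mulf_eq0 sqrf_eq0 (gt_eqF s_gt0) orbF.
    by rewrite addrC addr_eq0 => /eqP.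
  by move=> i /negbTE ->; rewrite mulr0n mulr0.
have A0 : A = 0.
  have : A = - A *+ k.
    by rewrite {1}/A (eq_bigr _ (fun j _ => aE j)) sumr_const card_ord.
  move/eqP; rewrite mulNrn -addr_eq0 -mulrS mulrn_eq0 /=.
  by move/eqP.
by apply/rowP => j; rewrite aE A0 oppr0 mxE.
Qed.

(** * Central configurations with positive masses *)

Section Masses.
Context {R : realType} {k : nat}.
Variables (m : 'I_k -> R) (q : 'I_k -> 'rV[R]_3).
Hypothesis m_gt0 : forall i, 0 < m i.

Lemma total_mass_gt0 (i : 'I_k) : 0 < total_mass m.
Proof.
rewrite /total_mass (bigD1 i)//= ltr_pwDl ?sumr_ge0// => j _.
exact: ltW.
Qed.

Lemma mass_centerB (i : 'I_k) :
  total_mass m *: (mass_center m q - q i) = \sum_j m j *: (q j - q i).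
Proof.
rewrite scalerBr scalerA divff ?gt_eqF ?(total_mass_gt0 i)// scale1r.
rewrite /total_mass scaler_suml -sumrB.
by apply: eq_bigr => j _; rewrite scalerBr.
Qed.

(** Replacing [c - q i] by a weighted sum of the [q j - q i] eliminates the centre of mass, which
    differs between a configuration and its subsets; [nu] is lambda divided by the total mass. The
    term [j = i] is harmless because [q j - q i] is then 0. *)
Lemma central_barycentric : central m q -> exists nu : R, forall i,
  \sum_j (m j * ((enorm (q j - q i) ^+ 3)^-1 - nu)) *: (q j - q i) = 0.
Proof.
move=> cmq; exists (potential m q / inertia m q / total_mass m) => i.
have M0 : total_mass m != 0 by rewrite gt_eqF ?(total_mass_gt0 i).
have /(congr1 (fun v => (m i)^-1 *: v)) := cmq i.
set l := potential _ _ / _; rewrite scaler_sumr scalerA.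
have mi0 : m i != 0 by rewrite gt_eqF.
rewrite mulrN mulrCA mulVf// mulr1 scaleNr -scalerN opprB.
rewrite -[l in _ = l *: _ -> _](divfK M0) -scalerA mass_centerB => E.
under eq_bigr do rewrite mulrBr scalerBl mulrC [m _ * (_ / _)]mulrC -scalerA.
rewrite sumrB; apply/eqP; rewrite subr_eq0; apply/eqP.
under [RHS]eq_bigr do rewrite -scalerA.
rewrite -scaler_sumr -E.
rewrite (bigD1 i)//= subrr !scaler0 add0r; apply: eq_bigr => j _.
by rewrite !scalerA; congr (_ *: _); rewrite !mulrA mulVf// mul1r mulrC.
Qed.

(** Leibniz's identity: expand each squared distance about [c]; the cross terms vanish since the
    weighted sum of the [q i - c] is 0. The factor 2 comes from counting ordered pairs. *)
Lemma inertia_pairs (i0 : 'I_k) :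
  \sum_i \sum_j m i * m j * enorm (q i - q j) ^+ 2
    = (total_mass m * inertia m q) *+ 2.
Proof.
set c := mass_center m q.
have cm0 : \sum_i m i *: (q i - c) = 0.
  have := mass_centerB i0.
  under eq_bigr do rewrite -(subrK c (q _)) -addrA scalerDr.
  rewrite big_split /= -scaler_suml -/c -/(total_mass m).
  by move/eqP; rewrite eq_sym -subr_eq0 addrK => /eqP.
have cross i : \sum_j m j * (\sum_l (q i - c) 0 l * (q j - c) 0 l) = 0.
  under eq_bigr do rewrite mulr_sumr.
  rewrite exchange_big big1// => l _.
  under eq_bigr do rewrite mulrCA.
  rewrite -mulr_sumr; have /rowP/(_ l) := cm0.
  rewrite summxE mxE; under eq_bigr do rewrite mxE.
  by move=> ->; rewrite mulr0.
transitivity (\sum_i (m i * enorm (q i - c) ^+ 2 * total_mass m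
                       + m i * inertia m q)).
  apply: eq_bigr => i _.
  transitivity (m i * enorm (q i - c) ^+ 2 * total_mass m + m i * inertia m q
      - m i *+ 2 * \sum_j m j * (\sum_l (q i - c) 0 l * (q j - c) 0 l)); last first.
    by rewrite cross mulr0 subr0.
  rewrite /total_mass /inertia !mulr_sumr -big_split -sumrB /=.
  apply: eq_bigr => j _.
  have -> : q i - q j = (q i - c) - (q j - c) by rewrite opprB addrA subrK.
  rewrite enorm_sqrB -/c; ring.
by rewrite big_split /= -!mulr_suml -/(total_mass m) -/(inertia m q); ring.
Qed.

(** At common distance [s] the force on body [i] is [m i / s ^+ 3] times
    [total_mass m *: (c - q i)], so only lambda = [total_mass m / s ^+ 3] is left to check; both U
    and I are computed from the pair sum [P]. *)
Lemma equidistant_central : (2 <= k)%N -> equidistant q -> central m q.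
Proof.
move=> k2 [s s0 qs].
pose i0 : 'I_k := Ordinal (ltnW k2); pose i1 : 'I_k := Ordinal k2.
pose P := \sum_(i < k) \sum_(j < k | (i < j)%N) m i * m j.
have P0 : 0 < P.
  have mm i j : 0 <= m i * m j by rewrite mulr_ge0// ltW.
  rewrite /P (bigD1 i0)//= (bigD1 i1)//= -addrA ltr_pwDl ?mulr_gt0//.
  by rewrite addr_ge0 ?sumr_ge0// => i _; rewrite ?sumr_ge0.
have UE : potential m q = P / s.
  rewrite /potential mulr_suml; apply: eq_bigr => i _.
  rewrite mulr_suml; apply: eq_bigr => j ij.
  by rewrite qs// -val_eqE /= ltn_eqF.
have IE : total_mass m * inertia m q = P * s ^+ 2.
  apply/(pmulrnI (isT : (0 < 2)%N)); rewrite /= -(inertia_pairs i0).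
  transitivity (\sum_(i < k) \sum_(j < k | (i < j)%N) m i * m j * s ^+ 2
              + \sum_(i < k) \sum_(j < k | (j < i)%N) m i * m j * s ^+ 2).
    rewrite -big_split; apply: eq_bigr => i _ /=.
    rewrite (bigID (fun j : 'I_k => (i < j)%N)) /=; congr (_ + _).
      by apply: eq_bigr => j ij; rewrite qs// -val_eqE /= ltn_eqF.
    rewrite (bigD1 i) ?ltnn//= subrr enorm0 expr0n mulr0 add0r.
    apply: eq_big => [j|j /andP[_ ij]]; last by rewrite qs// eq_sym.
    by rewrite -leqNgt -val_eqE /= [RHS]ltn_neqAle andbC.
  rewrite [X in _ + X](exchange_big_dep xpredT)//= mulr2n /P mulr_suml.
  congr (_ + _); apply: eq_bigr => i _; rewrite mulr_suml//.
  by apply: eq_bigr => j _; rewrite [m j * _]mulrC.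
move=> i; have M0 := total_mass_gt0 i.
have I0 : 0 < inertia m q by rewrite -(pmulr_rgt0 _ M0) IE mulr_gt0// exprn_gt0.
have -> : potential m q / inertia m q = total_mass m / s ^+ 3.
  apply/eqP; rewrite UE eqr_div ?lt0r_neq0 ?exprn_gt0// IE; apply/eqP.
  by rewrite mulrAC -mulrA; congr (_ * _); field; rewrite gt_eqF.
rewrite scaleNr -scalerN opprB.
have -> : total_mass m / s ^+ 3 * m i = (m i / s ^+ 3) * total_mass m by ring.
rewrite -scalerA mass_centerB scaler_sumr [RHS](bigD1 i)//= subrr !scaler0 add0r.
by apply: eq_bigr => j ji; rewrite qs// scalerA mulrAC.
Qed.

End Masses.

(* With [c] the common value, [x], [y] and [z] are roots of the cubic
   [g w^3 - c w^2 + K], which has no linear term: [g (xy + yz + zx) = 0], so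
   [g = 0], then [c = 0] and [K = 0]. *)
Lemma no_three_positive_roots (R : realFieldType) (K g x y z : R) :
  0 < K -> 0 < x -> 0 < y -> 0 < z -> x != y -> x != z -> y != z ->
  (K / x ^+ 3 + g) * x = (K / y ^+ 3 + g) * y ->
  (K / x ^+ 3 + g) * x = (K / z ^+ 3 + g) * z -> False.
Proof.
move=> K0 x0 y0 z0 xy xz yz; set c := LHS => cy cz.
have cubic w : 0 < w -> c = (K / w ^+ 3 + g) * w -> c * w ^+ 2 = K + g * w ^+ 3.
  by move=> w0 ->; field; rewrite gt_eqF.
have Ex := cubic x x0 erefl; have Ey := cubic y y0 cy; have Ez := cubic z z0 cz.
clearbody c.
(* Divided differences: subtract the cubic relations in pairs and cancel the differences of the
   roots, then do so once more to get [cE]. *)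
have Axy : c * (x + y) = g * (x ^+ 2 + x * y + y ^+ 2).
  by apply: (mulfI (_ : x - y != 0)); [rewrite subr_eq0|lra].
have Axz : c * (x + z) = g * (x ^+ 2 + x * z + z ^+ 2).
  by apply: (mulfI (_ : x - z != 0)); [rewrite subr_eq0|lra].
have cE : c = g * (x + y + z).
  by apply: (mulfI (_ : y - z != 0)); [rewrite subr_eq0|lra].
have /eqP : g * (x * y + x * z + y * z) = 0 by move: Axy; rewrite cE; lra.
have e2 : 0 < x * y + x * z + y * z by rewrite !addr_gt0 ?mulr_gt0.
rewrite mulf_eq0 (gt_eqF e2) orbF => /eqP g0.
by move: Ex; rewrite cE g0 !mul0r addr0 => K00; rewrite -K00 ltxx in K0.
Qed.

(** * Configurations central together with all their n-body subsets *)

Section AllSubsets.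
Context {R : realType} {n : nat}.
Variables (m : 'I_n.+1 -> R) (q : 'I_n.+1 -> 'rV[R]_3).
Hypotheses (m_gt0 : forall i, 0 < m i) (q_inj : injective q).
Hypothesis cmq : central m q.
Hypothesis cmq_lift : forall b : 'I_n.+1,
  central (fun i => m (lift b i)) (fun i => q (lift b i)).

Lemma interaction_const (b : 'I_n.+1) :
  exists (g : R) (v : 'rV[R]_3), forall i, i != b ->
    ((enorm (q i - q b) ^+ 3)^-1 + g) *: (q i - q b) = v.
Proof.
have [nu nuP] := central_barycentric _ _ m_gt0 cmq.
have [nub nubP] := central_barycentric _ _ (fun i => m_gt0 (lift b i)) (cmq_lift b).
pose Mb := \sum_i m (lift b i).
(* Subtraction leaves a multiple of the sum of [m j *: (q j - q i)] over the bodies other than [b].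
   Rebasing it at [q b] (equation [S]) splits off [Mb *: (q i - q b)], which is absorbed into [g];
   the remainder, independent of [i], is [v]. *)
exists ((nub - nu) * Mb / m b - nu).
exists (((nub - nu) / m b) *: \sum_i m (lift b i) *: (q (lift b i) - q b)).
move=> i; rewrite eq_sym => /unlift_some[j -> _] {i}.
have mb0 : m b != 0 by rewrite gt_eqF.
set p := q (lift b j).
have E : (m b * ((enorm (p - q b) ^+ 3)^-1 - nu)) *: (p - q b)
   = (nub - nu) *: \sum_i m (lift b i) *: (q (lift b i) - p).
  have /eqP := nuP (lift b j); rewrite (bigD1_ord b)//= -/p.
  rewrite enormB -[q b - p]opprB scalerN addrC subr_eq0 => /eqP <-.
  rewrite -[LHS]subr0 -[X in _ - X = _](nubP j) -sumrB scaler_sumr.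
  apply: eq_bigr => i _ /=.
  by rewrite -scalerBl scalerA; congr (_ *: _); ring.
have S : \sum_i m (lift b i) *: (q (lift b i) - p)
   = \sum_i m (lift b i) *: (q (lift b i) - q b) - Mb *: (p - q b).
  rewrite /Mb scaler_suml -sumrB; apply: eq_bigr => i _.
  by rewrite -scalerBr opprB addrA subrK.
apply: (scalerI mb0); rewrite !scalerA [m b * (_ / _)]mulrC divfK//.
move: E; rewrite S [(nub - nu) *: _]scalerBr scalerA => /eqP.
rewrite eq_sym subr_eq -scalerDl eq_sym => /eqP <-.
by congr (_ *: _); move: (_ ^- 3) => w; field.
Qed.

Lemma collinear_or_equidistant :
  (2 <= n)%N -> collinear q \/ equidistant q.
Proof.
move=> n2; have [|ncol] := EM (collinear q); [by left|right].
have eqd b i j : i != b -> j != b -> enorm (q i - q b) = enorm (q j - q b).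
  move=> ib jb; have [g [v gv]] := interaction_const b.
  have qb a : a != b -> 0 < enorm (q a - q b) by exact: enorm_subr_gt0.
  have [v0|v0] := eqVneq v 0; last first.
    exfalso; apply: ncol; exists (q b), v; split=> // a.
    have [->|ab] := eqVneq a b; first by exists 0; rewrite scale0r addr0.
    (* The coefficient is invertible: were it 0, [v] would be 0. *)
    exists ((enorm (q a - q b) ^+ 3)^-1 + g)^-1.
    rewrite -(gv a ab) scalerA mulVf; first by rewrite scale1r addrC subrK.
    by apply: contra v0 => /eqP h; rewrite -(gv a ab) h scale0r.
  have Sg a : a != b -> (enorm (q a - q b) ^+ 3)^-1 = - g.
    move=> ab; have /eqP := gv a ab; rewrite v0 scaler_eq0 => /orP[].
      by rewrite addr_eq0 => /eqP.
    by rewrite -[_ == 0]negbK -enorm_gt0 qb.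
  have /invr_inj : (enorm (q i - q b) ^+ 3)^-1 = (enorm (q j - q b) ^+ 3)^-1.
    by rewrite !Sg.
  by apply: pexpIrn => //; rewrite nnegrE ltW// qb.
pose i1 : 'I_n.+1 := Ordinal (ltnW n2 : (1 < n.+1)%N).
exists (enorm (q i1 - q ord0)); first exact: enorm_subr_gt0.
(* [eqd] compares only distances to a common body, so the pair [i], [j] is linked to the reference
   pair through body 0. *)
move=> i j ij; have [j0|j0] := eqVneq j ord0.
  by rewrite j0 in ij *; apply: eqd.
rewrite (eqd j i ord0)// 1?eq_sym// enormB.
exact: eqd.
Qed.

Lemma collinear_card : collinear q -> (n <= 2)%N.
Proof.
move=> [a [u [u0 qu]]]; rewrite leqNgt; apply/negP => n3.
have [t tE] := choice qu.
(* At an endpoint all [t i - t b] are positive, so the norm loses its absolute value and every other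
   body satisfies the same cubic. *)
pose b := [arg min_(i < ord0) t i]%O.
have tb i : i != b -> 0 < t i - t b.
  move=> ib; rewrite subr_gt0 lt_neqAle.
  apply/andP; split.
    by apply: contra ib => /eqP h; apply/eqP/q_inj; rewrite !tE h.
  by rewrite /b; case: arg_minP => // j _; apply.
have [g [v gv]] := interaction_const b.
pose K := (enorm u ^+ 3)^-1.
have K0 : 0 < K by rewrite invr_gt0 exprn_gt0// enorm_gt0.
have root i : i != b -> ((K / (t i - t b) ^+ 3 + g) * (t i - t b)) *: u = v.
  move=> ib; rewrite -(gv i ib).
  have -> : q i - q b = (t i - t b) *: u.
    by rewrite !tE opprD addrACA subrr add0r scalerBl.
  rewrite enormZ gtr0_norm ?tb// exprMn scalerA.
  by rewrite [(_ * enorm u ^+ 3)^-1]invfM -/K [K / _]mulrC.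
have rootE i j : i != b -> j != b ->
    (K / (t i - t b) ^+ 3 + g) * (t i - t b)
      = (K / (t j - t b) ^+ 3 + g) * (t j - t b).
  move=> ib jb; apply/eqP; rewrite -subr_eq0.
  have : u != 0 by []; apply: contraNT => h.
  have /eqP := root i ib; rewrite -(root j jb) -subr_eq0 -scalerBl scaler_eq0.
  by rewrite (negbTE h).
have t_inj i j : i != j -> t i - t b != t j - t b.
  by apply: contra => /eqP/addIr h; apply/eqP/q_inj; rewrite !tE h.
(* If [n] were at least 3, the indices 0, 1, 2 would give three distinct bodies other than [b],
   hence three roots. *)
pose o l (ln : (l < n)%N) := lift b (Ordinal ln).
have ob l ln : o l ln != b by rewrite eq_sym neq_lift.
have oo l l' ln ln' : l != l' -> o l ln != o l' ln'.
  by move=> ll; rewrite (inj_eq lift_inj).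
have n2 : (1 < n)%N by exact: ltnW.
have n1 : (0 < n)%N by exact: ltnW.
apply: (no_three_positive_roots _ K g _ _ _ K0
    (tb _ (ob _ n1)) (tb _ (ob _ n2)) (tb _ (ob _ n3))).
- exact/t_inj/oo.
- exact/t_inj/oo.
- exact/t_inj/oo.
- exact: rootE.
- exact: rootE.
Qed.

End AllSubsets.

Theorem proposition1 (R : realType) (n : nat) (hn : (2 <= n)%N)
    (m : 'I_n.+1 -> R) (q : 'I_n.+1 -> 'rV[R]_3)
    (m_gt0 : forall i, 0 < m i) (q_inj : injective q) :
  (central m q /\
   forall b : 'I_n.+1, central (fun i => m (lift b i)) (fun i => q (lift b i)))
  <->
  [\/ eulerian m q, equilateral_triangle q | regular_tetrahedron q].
Proof.
split=> [[cmq cmq_lift]|].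
  have n_small : collinear q -> n = 2%N.
    by move=> /(collinear_card _ _ m_gt0 q_inj cmq cmq_lift) n2; apply/anti_leq/andP.
  have [col|eqd] := collinear_or_equidistant _ _ m_gt0 q_inj cmq cmq_lift hn.
    by apply: Or31; split=> //; rewrite (n_small col).
  have n3 : (n <= 3)%N.
    by have [s s0 qs] := eqd; apply: equidistant_card s0 qs.
  move: hn n3; rewrite leq_eqVlt => /orP[/eqP n2 _|n3 n3'].
    by apply: Or32; split=> //; rewrite -n2.
  by apply: Or33; split=> //; congr S; apply/anti_leq/andP.
(* Equidistance passes to subsets, and it implies centrality for any positive masses. *)
have lift_central : equidistant q -> forall b,
    central (fun i => m (lift b i)) (fun i => q (lift b i)).
  move=> [s s0 qs] b; apply: equidistant_central => //.
  by exists s => // i j ij; rewrite qs// (inj_eq lift_inj).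
have eqd_central : equidistant q -> central m q.
  by apply: equidistant_central => //; apply: ltnW.
move=> [[[n2] _ cmq]|[_ eqd]|[_ eqd]]; last 2 first.
- by split; [exact: eqd_central|exact: lift_central].
- by split; [exact: eqd_central|exact: lift_central].
have {n2} n2 : n = 2%N by exact: n2.
(* In the Eulerian case the subsets have two bodies and a single mutual distance, so they are
   equidistant. *)
split=> // b; subst n; apply: equidistant_central => //.
exists (enorm (q (lift b ord0) - q (lift b ord_max))).
  by rewrite enorm_gt0 subr_eq0 (inj_eq q_inj) (inj_eq lift_inj).
move=> i j; case: i j => [[|[|?]] // ?] [[|[|?]] // ?] // _.
  by congr (enorm (q (lift b _) - q (lift b _))); apply: val_inj.
by rewrite enormB; congr (enorm (q (lift b _) - q (lift b _))); apply: val_inj.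
Qed.
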